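(* Let $n\ge 1$, $k\ge n$, $\rho\in(0,1)$, let $\mathbf{x}_1,\dots,\mathbf{x}_{k+2}\in\mathbb{R}^n$, and put $\mathbf{y}_j=\mathbf{x}_{j+1}$. Let $$\mathbf{X}_k=\begin{bmatrix}\rho^{k-1}\mathbf{x}_1&\rho^{k-2}\mathbf{x}_2&\cdots&\mathbf{x}_k\end{bmatrix},\qquad \mathbf{Y}_k=\begin{bmatrix}\rho^{k-1}\mathbf{y}_1&\rho^{k-2}\mathbf{y}_2&\cdots&\mathbf{y}_k\end{bmatrix},$$ $$\mathbf{X}_{k+1}=\begin{bmatrix}\rho\mathbf{X}_k&\mathbf{x}_{k+1}\end{bmatrix},\qquad \mathbf{Y}_{k+1}=\begin{bmatrix}\rho\mathbf{Y}_k&\mathbf{y}_{k+1}\end{bmatrix}.$$ Let the singular value decomposition $\mathbf{X}_k=\mathbf{U}_{x_k}\mathbf{\Sigma}_{x_k}\mathbf{V}_{x_k}^*$ be known, and let the matrix (DMD operator) $\mathbf{A}^{\rho}_k\in\mathbb{R}^{n\times n}$ minimize the weighted cost $J_k(\mathbf{A})=\sum_{j=1}^{k}\|\rho^{k-j}(\mathbf{y}_j-\mathbf{A}\mathbf{x}_j)\|^2$ over $\mathbf{A}\in\mathbb{R}^{n\times n}$. Assume that a new pair of measurements $(\mathbf{x}_{k+1},\mathbf{y}_{k+1})$ is used to compute incrementally the SVD $\mathbf{X}_{k+1}=\mathbf{U}_{x_{k+1}}\mathbf{\Sigma}_{x_{k+1}}\mathbf{V}_{x_{k+1}}^*$ by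 the weighted incremental SVD update (defined in the context), which also produces the row vector $\mathbf{v}_{s_{k,2}}\in\mathbb{C}^{1\times n}$. Then the matrix $\mathbf{A}^{\rho}_{k+1}\in\mathbb{R}^{n\times n}$ which minimizes $J_{k+1}(\mathbf{A})=\sum_{j=1}^{k+1}\|\rho^{k+1-j}(\mathbf{y}_j-\mathbf{A}\mathbf{x}_j)\|^2$ over $\mathbf{A}\in\mathbb{R}^{n\times n}$ is $$\mathbf{A}^{\rho}_{k+1}=\mathbf{A}^{\rho}_{k}+\left(\mathbf{y}_{k+1}-\mathbf{A}^{\rho}_{k}\mathbf{x}_{k+1}\right)\mathbf{v}_{s_{k,2}}\mathbf{\Sigma}_{x_{k+1}}^{-1}\mathbf{U}_{x_{k+1}}^*.$$
   Context: $\|\cdot\|$ is the Euclidean norm and $(\cdot)^*$ the conjugate transpose. SVD convention: for an $n\times m$ matrix with $m\ge n$, an SVD $\mathbf{U}\mathbf{\Sigma}\mathbf{V}^*$ has $\mathbf{U}\in\mathbb{C}^{n\times n}$ unitary, $\mathbf{\Sigma}=\mathrm{diag}\{\sigma_1,\dots,\sigma_n\}\in\mathbb{C}^{n\times n}$ the diagonal matrix of singular values, and $\mathbf{V}\in\mathbb{C}^{m\times n}$ with orthonormal columns. Weighted incremental SVD update: given the SVD $\mathbf{X}_k=\mathbf{U}_{x_k}\mathbf{\Sigma}_{x_k}\mathbf{V}_{x_k}^*$ and the new datum $\mathbf{x}_{k+1}$, take an SVD $$\mathbf{S}_k=\begin{bmatrix}\mathbf{\Sigma}_{x_k}&\rho^{-1}\mathbf{U}_{x_k}^*\mathbf{x}_{k+1}\end{bmatrix}=\mathbf{U}_{s_k}\mathbf{\Sigma}_{s_k}\mathbf{V}_{s_k}^*,$$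 with $\mathbf{U}_{s_k},\mathbf{\Sigma}_{s_k}\in\mathbb{C}^{n\times n}$ and $\mathbf{V}_{s_k}\in\mathbb{C}^{(n+1)\times n}$, and partition $\mathbf{V}_{s_k}=\begin{bmatrix}\mathbf{V}_{s_{k,1}}\\ \mathbf{v}_{s_{k,2}}\end{bmatrix}$ with $\mathbf{V}_{s_{k,1}}\in\mathbb{C}^{n\times n}$ and $\mathbf{v}_{s_{k,2}}\in\mathbb{C}^{1\times n}$ (the last row). The update sets $$\mathbf{U}_{x_{k+1}}=\mathbf{U}_{x_k}\mathbf{U}_{s_k},\quad \mathbf{\Sigma}_{x_{k+1}}=\rho\,\mathbf{\Sigma}_{s_k},\quad \mathbf{V}_{x_{k+1}}=\begin{bmatrix}\mathbf{V}_{x_k}\mathbf{V}_{s_{k,1}}\\ \mathbf{v}_{s_{k,2}}\end{bmatrix}.$$ *)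

(* Defs.v *)
From mathcomp Require Import all_boot all_order all_algebra.
From mathcomp Require Import reals.
From mathcomp Require Import complex.

Set Implicit Arguments.
Unset Strict Implicit.
Unset Printing Implicit Defensive.

Import Order.TTheory GRing.Theory Num.Theory.
Local Open Scope ring_scope.
Local Open Scope complex_scope.
Local Open Scope sesquilinear_scope.

Definition enorm (R : realType) (n : nat) (v : 'cV[R]_n) : R :=
  Num.sqrt (\sum_i v i 0 ^+ 2).

Definition minimizes (R : realType) (T : Type) (f : T -> R) (a : T) : Prop :=
  forall b, f a <= f b.

(* Sequences of measurements are indexed from 1; the value at 0 is never
   used. *)
Definition wcost (R : realType) (n : nat) (rho : R) (x y : nat -> 'cV[R]_n)
    (k : nat) (A : 'M[R]_n) : R :=
  \sum_(1 <= j < k.+1) enorm (rho ^+ (k - j) *: (y j - A *m x j)) ^+ 2.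

(* The matrix [rho^(k-1) x_1, rho^(k-2) x_2, ..., x_k]; its 0-based column j
   carries x_(j+1). *)
Definition wdata (R : realType) (n : nat) (rho : R) (x : nat -> 'cV[R]_n)
    (k : nat) : 'M[R]_(n, k) :=
  \matrix_(i < n, j < k) (rho ^+ (k - j.+1) * x j.+1 i 0).

Definition cmx (R : realType) (m n : nat) (A : 'M[R]_(m, n)) : 'M[R[i]]_(m, n) :=
  map_mx (real_complex R) A.

(* Economy-size SVD of a wide matrix; the singular values are not required to
   be sorted. In R[i], [0 <= z] says that z is real and nonnegative, and
   [V^t* *m V = 1%:M], orthonormality of the columns of V, forces n <= m. *)
Definition is_svd (R : realType) (n m : nat) (X : 'M[R[i]]_(n, m))
    (U S : 'M[R[i]]_n) (V : 'M[R[i]]_(m, n)) : Prop :=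
  [/\ U \is unitarymx,
      is_diag_mx S /\ (forall i, 0 <= S i i),
      V^t* *m V = 1%:M &
      X = U *m S *m V^t*].

(* (Us, Ss, Vs) is any SVD of the auxiliary matrix [S, rho^-1 U^* x], and
   (U', S', V') are the updated factors. *)
Definition weighted_isvd_update (R : realType) (n k : nat) (rho : R)
    (U S : 'M[R[i]]_n) (V : 'M[R[i]]_(k, n)) (x : 'cV[R]_n)
    (Us Ss : 'M[R[i]]_n) (Vs : 'M[R[i]]_(n + 1, n))
    (U' S' : 'M[R[i]]_n) (V' : 'M[R[i]]_(k + 1, n)) : Prop :=
  [/\ is_svd (row_mx S (rho%:C^-1 *: (U^t* *m cmx x))) Us Ss Vs,
      U' = U *m Us,
      S' = rho%:C *: Ss &
      V' = col_mx (V *m usubmx Vs) (dsubmx Vs)].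

(* Hence no separate hypothesis is needed saying that the updated factors are an
   SVD of X_(k+1) = [rho X_k, x_(k+1)], where X_k = wdata rho x k. *)
Lemma weighted_isvd_updateP (R : realType) (n k : nat) (rho : R)
    (X : 'M[R]_(n, k)) (x : 'cV[R]_n) U S V Us Ss Vs U' S' V' :
  0 < rho -> is_svd (cmx X) U S V ->
  weighted_isvd_update rho U S V x Us Ss Vs U' S' V' ->
  is_svd (cmx (row_mx (rho *: X) x)) U' S' V'.
Proof.
move=> rho0 [uU _ oV XE] [[uUs [dSs Ss0] oVs SE] -> -> ->].
have rhoC0 : rho%:C != 0 :> R[i] by rewrite fmorph_eq0 gt_eqF.
have adjM m p q (A : 'M[R[i]]_(m, p)) (B : 'M_(p, q)) :
  (A *m B)^t* = B^t* *m A^t* by rewrite trmx_mul map_mxM.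
have adjcol m p q (A : 'M[R[i]]_(m, q)) (B : 'M_(p, q)) :
  (col_mx A B)^t* = row_mx (A^t*) (B^t*) by rewrite tr_col_mx map_row_mx.
have VsE : Vs^t* = row_mx ((usubmx Vs)^t*) ((dsubmx Vs)^t*).
  by rewrite -adjcol vsubmxK.
split.
- exact: mul_unitarymx.
- split=> [|i]; last first.
    by rewrite mxE mulr_ge0 // lecR ltW.
  apply/is_diag_mxP => i j ij; rewrite mxE.
  by move/is_diag_mxP: dSs => ->; rewrite ?mulr0.
- rewrite adjcol mul_row_col adjM -mulmxA (mulmxA (V^t*)) oV mul1mx.
  by rewrite -oVs VsE -[in X in _ = _ *m X](vsubmxK Vs) mul_row_col.
- have -> : cmx (row_mx (rho *: X) x) = row_mx (rho%:C *: cmx X) (cmx x).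
    by rewrite /cmx map_row_mx map_mxZ.
  move: SE; rewrite VsE mul_mx_row => /eq_row_mx[SE xE].
  rewrite adjcol adjM mul_mx_row -scalemxAr -!scalemxAl; congr row_mx.
    by rewrite XE {1}SE !mulmxA.
  rewrite -!mulmxA (mulmxA Us) -xE -scalemxAr scalerA mulfV // scale1r.
  by rewrite mulmxA (unitarymxP uU) mul1mx.
Qed.

(* Main.v *)
(** [A] is a least-squares minimizer for data [X, Y] iff the normal equation
    [(Y - A X) X^T = 0] holds. Passing to [X' = [rho X, x]], [Y' = [rho Y, y]]
    leaves the residual [(Y' - A X') X'^T = (y - A x) x^T], so the correction to
    [A] is [(y - A x) x^T G^-1] with [G = X' X'^T]. Substituting the SVD
    [X' = U S V^*], one has [G = U S^2 U^*] and, reading off the last column,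
    [x = U S v^*] with [v] the last row of [V], whence
    [x^T G^-1 = v S^-1 U^*]. *)

Require Import Defs.
From mathcomp Require Import all_boot all_order all_algebra.
From mathcomp Require Import reals.
From mathcomp Require Import complex.
From mathcomp Require Import ring lra.

Import Order.TTheory GRing.Theory Num.Theory.
Local Open Scope ring_scope.
Local Open Scope complex_scope.
Local Open Scope sesquilinear_scope.

(** The squared Frobenius norm, written as a trace so that cost expansions become matrix algebra. *)
Definition sqnorm {R : realType} {m n : nat} (M : 'M[R]_(m, n)) : R :=
  \tr (M *m M^T).

Lemma sqnormE {R : realType} {m n : nat} (M : 'M[R]_(m, n)) :
  sqnorm M = \sum_i \sum_j M i j ^+ 2.
Proof.
by apply: eq_bigr => i _; rewrite mxE; apply: eq_bigr => j _; rewrite mxE expr2.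
Qed.

Lemma sqnorm_ge0 {R : realType} {m n : nat} (M : 'M[R]_(m, n)) : 0 <= sqnorm M.
Proof. by rewrite sqnormE; do 2!apply: sumr_ge0 => ? _; exact: sqr_ge0. Qed.

Lemma sqnorm_eq0 {R : realType} {m n : nat} (M : 'M[R]_(m, n)) :
  sqnorm M = 0 -> M = 0.
Proof.
rewrite sqnormE => /psumr_eq0P M0; apply/matrixP => i j; rewrite mxE.
have /M0 /(_ i isT) /psumr_eq0P Mi0 : forall i, true -> 0 <= \sum_j M i j ^+ 2.
  by move=> *; apply: sumr_ge0 => *; exact: sqr_ge0.
by apply/eqP; rewrite -sqrf_eq0 Mi0 // => *; exact: sqr_ge0.
Qed.

Lemma sqnormZ {R : realType} {m n : nat} (a : R) (M : 'M[R]_(m, n)) :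
  sqnorm (a *: M) = a ^+ 2 * sqnorm M.
Proof.
by rewrite /sqnorm linearZ /= -scalemxAl -scalemxAr scalerA mxtraceZ expr2.
Qed.

Lemma sqnormN {R : realType} {m n : nat} (M : 'M[R]_(m, n)) :
  sqnorm (- M) = sqnorm M.
Proof. by rewrite /sqnorm linearN /= mulNmx mulmxN opprK. Qed.

Lemma sqnormD {R : realType} {m n : nat} (M N : 'M[R]_(m, n)) :
  sqnorm (M + N) = sqnorm M + 2 * \tr (M *m N^T) + sqnorm N.
Proof.
rewrite /sqnorm linearD /= mulmxDl !mulmxDr !mxtraceD.
rewrite -[\tr (N *m M^T)]mxtrace_tr trmx_mul trmxK; ring.
Qed.

Lemma sqnorm_row_mx {R : realType} {m n1 n2 : nat} (M : 'M[R]_(m, n1))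
    (N : 'M[R]_(m, n2)) : sqnorm (row_mx M N) = sqnorm M + sqnorm N.
Proof. by rewrite /sqnorm tr_row_mx mul_row_col mxtraceD. Qed.

Lemma sqnorm_enorm {R : realType} {n : nat} (v : 'cV[R]_n) :
  enorm v ^+ 2 = sqnorm v.
Proof.
rewrite /enorm sqr_sqrtr; last by apply: sumr_ge0 => *; exact: sqr_ge0.
by rewrite sqnormE; apply: eq_bigr => i _; rewrite big_ord1.
Qed.

Definition lsq {R : realType} {n m k : nat} (X : 'M[R]_(n, k)) (Y : 'M[R]_(m, k))
  (A : 'M[R]_(m, n)) : R := sqnorm (Y - A *m X).

(** The cost is exactly quadratic in a perturbation [D] of [A], with linear part [-2 tr (N D^T)],
    [N = (Y - A X) X^T]. If [N = 0], only a nonnegative term is added; otherwise a short step along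
    [N] lowers the cost. *)
Lemma normal_equation {R : realType} {n m k : nat} (X : 'M[R]_(n, k))
    (Y : 'M[R]_(m, k)) (A : 'M[R]_(m, n)) :
  minimizes (lsq X Y) A <-> (Y - A *m X) *m X^T = 0.
Proof.
have lsqD (D : 'M_(m, n)) : lsq X Y (A + D) = lsq X Y A
    - 2 * \tr ((Y - A *m X) *m X^T *m D^T) + sqnorm (D *m X).
  rewrite /lsq mulmxDl opprD addrA (sqnormD (_ - _)) linearN /= trmx_mul mulmxN linearN.
  by rewrite /= mulmxA mulrN sqnormN.
split=> [minA|E0 B]; last first.
  rewrite -(subrKC A B) lsqD E0 mul0mx mxtrace0 mulr0 subr0.
  by rewrite lerDl sqnorm_ge0.
set N := (Y - A *m X) *m X^T; apply: sqnorm_eq0.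
set b := sqnorm (N *m X); have b0 : 0 <= b := sqnorm_ge0 _.
(* Step of length [t] along the steepest descent direction [N]. *)
pose t := sqnorm N / (b + 1).
have tE : sqnorm N = t * (b + 1) by rewrite /t divfK // gt_eqF //; lra.
have := minA (A + t *: N).
rewrite lsqD -/N linearZ /= -scalemxAr mxtraceZ -/(sqnorm N) -scalemxAl.
rewrite sqnormZ -/b tE.
(* Minimality now reads [2 t^2 (b + 1) <= t^2 b], that is [t^2 (b + 2) <= 0], where [b >= 0]. *)
move=> le0; have t20 : t ^+ 2 <= 0.
  have := sqr_ge0 t; nra.
have /eqP : t ^+ 2 = 0 by apply/eqP; rewrite eq_le t20 sqr_ge0.
by rewrite sqrf_eq0 => /eqP ->; rewrite mul0r.
Qed.

Lemma wcost_lsq {R : realType} {n : nat} (rho : R) (x y : nat -> 'cV[R]_n)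
    (k : nat) (A : 'M[R]_n) :
  wcost rho x y k A = lsq (wdata rho x k) (wdata rho y k) A.
Proof.
rewrite /wcost /lsq sqnormE exchange_big big_add1 big_mkord.
apply: eq_bigr => j _ /=; rewrite sqnorm_enorm sqnormE; apply: eq_bigr => i _.
rewrite big_ord1 !mxE mulrBr; congr ((_ - _) ^+ 2).
by rewrite mulr_sumr; apply: eq_bigr => l _; rewrite !mxE mulrCA.
Qed.

(** Each old residual gains one factor [rho], and the new one has weight 1. The block form is the
    matrix whose SVD the update delivers. *)
Lemma wcostS {R : realType} {n : nat} (rho : R) (x y : nat -> 'cV[R]_n)
    (k : nat) (A : 'M[R]_n) :
  wcost rho x y k.+1 A =
  lsq (row_mx (rho *: wdata rho x k) (x k.+1))
      (row_mx (rho *: wdata rho y k) (y k.+1)) A.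
Proof.
rewrite /lsq mul_mx_row opp_row_mx add_row_mx sqnorm_row_mx -scalemxAr -scalerBr.
rewrite sqnormZ -/(lsq (wdata rho x k) (wdata rho y k) A) -wcost_lsq /wcost.
rewrite big_nat_recr //= subnn scale1r.
rewrite sqnorm_enorm mulr_sumr; congr (_ + _).
apply: eq_big_nat => j /andP[_ jk].
by rewrite !sqnorm_enorm !sqnormZ mulrA subSn // (exprS rho (k - j)) exprMn.
Qed.

Lemma minimizes_ext {R : realType} {T : Type} {f g : T -> R} (a : T) :
  f =1 g -> minimizes f a <-> minimizes g a.
Proof. by move=> fg; split=> min_a b; have := min_a b; rewrite !fg. Qed.

Lemma cmx_adj {R : realType} {m n : nat} (X : 'M[R]_(m, n)) :
  (cmx X)^t* = cmx X^T.
Proof. by apply/matrixP => i j; rewrite !mxE; exact: conjc_real. Qed.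

Lemma nneg_diag_adj {R : realType} {n : nat} (S : 'M[R[i]]_n) :
  is_diag_mx S -> (forall i, 0 <= S i i) -> S^t* = S.
Proof.
move=> /is_diag_mxP dS S0; apply/matrixP => i j; rewrite !mxE.
have [->|ij] := eqVneq i j; first by apply/CrealP/ger0_real.
by rewrite !dS ?rmorph0 // eq_sym.
Qed.

Lemma adj_mulmx {R : realType} {m n p : nat} (A : 'M[R[i]]_(m, n))
    (B : 'M[R[i]]_(n, p)) : (A *m B)^t* = B^t* *m A^t*.
Proof. by rewrite trmx_mul map_mxM. Qed.

(** [X] is real, so its transpose is its adjoint; the inner [V^t* V] cancels and [S] is
    self-adjoint. *)
Lemma svd_gram {R : realType} {n m : nat} (X : 'M[R]_(n, m)) U S V :
  is_svd (cmx X) U S V -> cmx (X *m X^T) = U *m (S *m S) *m U^t*.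
Proof.
case=> _ [dS S0] oV XE; rewrite /cmx map_mxM -!/(cmx _) -cmx_adj XE.
rewrite !adj_mulmx trmxCK (nneg_diag_adj S dS S0) -!mulmxA; congr (_ *m (_ *m _)).
by rewrite (mulmxA (V^t* )) oV mul1mx.
Qed.

Theorem theorem1 (R : realType) (n k : nat) (hn : (1 <= n)%N) (hk : (n <= k)%N)
    (rho : R) (hrho0 : 0 < rho) (hrho1 : rho < 1)
    (x y : nat -> 'cV[R]_n) (hy : forall j : nat, y j = x j.+1)
    (Ux Sx : 'M[R[i]]_n) (Vx : 'M[R[i]]_(k, n))
    (hX : is_svd (cmx (wdata rho x k)) Ux Sx Vx)
    (A : 'M[R]_n) (hA : minimizes (wcost rho x y k) A)
    (Us Ss : 'M[R[i]]_n) (Vs : 'M[R[i]]_(n + 1, n))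
    (Ux' Sx' : 'M[R[i]]_n) (Vx' : 'M[R[i]]_(k + 1, n))
    (hupd : weighted_isvd_update rho Ux Sx Vx (x k.+1) Us Ss Vs Ux' Sx' Vx')
    (hSx' : Sx' \in unitmx) :
  exists A' : 'M[R]_n,
    [/\ minimizes (wcost rho x y k.+1) A',
        (forall B : 'M[R]_n, minimizes (wcost rho x y k.+1) B -> B = A') &
        cmx A' = cmx A + cmx (y k.+1 - A *m x k.+1)
                         *m dsubmx Vs *m invmx Sx' *m Ux'^t*].
Proof.
have svd' := weighted_isvd_updateP hrho0 hX hupd.
have [uU [dS S0] _ XE] := svd'.
have [_ _ _ V'E] := hupd.
have Sadj := nneg_diag_adj _ dS S0.
have UU : Ux'^t* *m Ux' = 1%:M by apply/mulmx1C/unitarymxP.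
set X' := row_mx (rho *: wdata rho x k) (x k.+1) in svd' XE *.
set Y' := row_mx (rho *: wdata rho y k) (y k.+1).
have minS B : minimizes (wcost rho x y k.+1) B <-> (Y' - B *m X') *m X'^T = 0.
  by rewrite (minimizes_ext _ (wcostS rho x y k)); exact: normal_equation.
have GE := svd_gram _ _ _ _ svd'.
set G := X' *m X'^T in GE *.
set e := y k.+1 - A *m x k.+1.
(* Invertibility is tested over the complex numbers, where [G] is a product of invertible
   factors. *)
have uG : G \in unitmx.
  rewrite -(map_unitmx (real_complex R)) -/(cmx G) GE !unitmx_mul hSx'.
  by have [-> ->] := mulmx1_unit UU.
have E'E : (Y' - A *m X') *m X'^T = e *m (x k.+1)^T.
  move/(minimizes_ext _ (wcost_lsq rho x y k))/normal_equation: hA => E0.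
  rewrite mul_mx_row opp_row_mx add_row_mx tr_row_mx mul_row_col.
  rewrite -scalemxAr -scalerBr linearZ /= -scalemxAl -scalemxAr E0.
  by rewrite !scaler0 add0r.
(* The witness is built from real data; the complex SVD formula is matched to it only at the end. *)
pose A' := A + e *m (x k.+1)^T *m invmx G.
have A'E : (Y' - A' *m X') *m X'^T = 0.
  rewrite [A' *m X']mulmxDl opprD addrA mulmxBl E'E -(mulmxA _ X') -/G.
  by rewrite mulmxKV // subrr.
exists A'; split; first exact/minS.
- move=> B /minS BE.
  (* Subtracting the two normal equations gives [(B - A') G = 0], and [G] is invertible. *)
  apply: (can_inj (mulmxK uG)); apply/eqP; rewrite -subr_eq0 -mulmxBl mulmxA.
  have -> : (B - A') *m X' = (Y' - A' *m X') - (Y' - B *m X').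
    by rewrite mulmxBl opprB [RHS]addrC addrA subrK.
  by rewrite mulmxBl A'E BE subrr.
rewrite /A' /cmx map_mxD !map_mxM -!/(cmx _) -!mulmxA; congr (_ + _ *m _).
have xE : cmx (x k.+1) = Ux' *m Sx' *m (dsubmx Vs)^t*.
  move: XE; rewrite V'E /cmx map_row_mx tr_col_mx map_row_mx mul_mx_row.
  by case/eq_row_mx.
have <- : (cmx (x k.+1))^t* = cmx (x k.+1)^T by exact: cmx_adj.
rewrite xE !adj_mulmx trmxCK Sadj -!mulmxA; congr (_ *m _).
have uGC : cmx G \in unitmx by rewrite map_unitmx.
(* It remains to see that [S U^t* G^-1 = S^-1 U^t*]; multiplied on the right by [G = U S^2 U^t*],
   both sides become [S U^t*]. *)
apply: (can_inj (mulmxK uGC)).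
rewrite -!mulmxA -map_mxM mulVmx // map_mx1 mulmx1 GE !mulmxA.
by rewrite -(mulmxA (invmx _)) UU mulmx1 mulVmx // mul1mx.
Qed.
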